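(* Let $(N_k)_{k\ge1}$ be any sequence of positive integers and let $p\in(0,1)$ with $p\ne 1/2$. For $x\in\{0,1\}^{\mathbb N}$ let $M_k^x(\omega)=\#\{1\le j\le N_k:(x_j,\dots,x_{j+k-1})=\omega\}$, where $\omega\in\{0,1\}^k$ is random with law $\mathrm{Ber}(p)^k$. Then for $\mathrm{Ber}(p)^{\mathbb N}$-almost every $x\in\{0,1\}^{\mathbb N}$, the sequence $M_k^x$ does not converge in distribution (as $k\to\infty$) to any non-zero random variable, i.e. to any real random variable that is not almost surely equal to $0$.
   Context: $\mathbb N=\{1,2,3,\dots\}$. $\mathrm{Ber}(p)=p\delta_1+(1-p)\delta_0$ is the Bernoulli law on $\{0,1\}$; $\mathrm{Ber}(p)^k$ and $\mathrm{Ber}(p)^{\mathbb N}$ are the product measures on $\{0,1\}^k$ and $\{0,1\}^{\mathbb N}$. *)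

(* Defs.v *)
From HB Require Import structures.
From mathcomp Require Import all_boot all_order all_algebra.
From mathcomp Require Import all_classical all_reals all_analysis.
From mathcomp Require Import measurable_realfun lebesgue_measure probability.
From mathcomp Require Import ring lra.
Set Implicit Arguments.
Unset Strict Implicit.
Unset Printing Implicit Defensive.
Import Order.TTheory GRing.Theory Num.Theory.
Import numFieldNormedType.Exports.
Local Open Scope classical_set_scope.
Local Open Scope ring_scope.

(* The product sigma-algebra on {0,1}^nat is generated by the coordinate
   projections; true stands for 1 and false for 0, and the coordinates
   x_1, x_2, ... are x 0, x 1, ... *)
Definition coordinate_sets : set (set (nat -> bool)) :=
  [set C | exists i (B : set bool), C = [set x | B (x i)]].

Definition binary_seq := g_sigma_algebraType coordinate_sets.

(* P is the product measure Ber(p)^nat. *)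
Definition is_bernoulli_product (R : realType) (p : R)
    (P : probability binary_seq R) : Prop :=
  forall n (A : nat -> set bool),
    P [set x | forall i, (i < n)%N -> A i (x i)] =
    (\prod_(i < n) bernoulli_prob p (A i))%E.

(* Existence: cut [0, 1[ at coin_prob into two intervals, rescale each of them to
   [0, 1[, and iterate; the itinerary of a uniform point has law Ber(coin_prob)^nat.
   Outside 0 <= p <= 1, bernoulli_prob p is the Dirac mass at false, whence
   the value 0 of coin_prob. *)
Section bernoulli_product_exists.
Context (R : realType) (p : R).

Definition coin_prob : R := if 0 <= p <= 1 then p else 0.

Lemma coin_prob01 : 0 <= coin_prob <= 1.
Proof. by rewrite /coin_prob; case: ifP => //; rewrite lexx ler01. Qed.

Lemma bernoulli_prob1 b : bernoulli_prob p [set b] = (bernoulli_pmf coin_prob b)%:E.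
Proof.
rewrite /bernoulli_prob /coin_prob; case: ifPn => h; first by rewrite fsbig_set1.
rewrite /dirac/= indicE; case: b => /=; rewrite ?subr0.
  by rewrite memNset.
by rewrite mem_set.
Qed.

Definition coin_step (u : R) : R := if u < coin_prob then u / coin_prob else (u - coin_prob) / (1 - coin_prob).
Definition coin_digits (u : measurableTypeR R) : binary_seq :=
  fun n => iter n coin_step (u : R) < coin_prob.

Lemma coin_digitsS u n : coin_digits u n.+1 = coin_digits (coin_step u) n.
Proof. by rewrite /coin_digits iterSr. Qed.

Lemma coin_cylinder (w : seq bool) : exists ab : R * R,
  [/\ 0 <= ab.1, ab.2 <= 1, ab.1 <= ab.2,
   ab.2 - ab.1 = \prod_(b <- w) bernoulli_pmf coin_prob b &
   forall u, 0 <= u < 1 ->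
     (forall i, (i < size w)%N -> coin_digits u i = nth false w i) <->
       ab.1 <= u < ab.2].
Proof.
have /andP[q0 q1] := coin_prob01.
elim: w => [|b w [[a c] /= [a0 c1 ac cE H]]].
  by exists (0, 1); split; rewrite ?big_nil//= ?subr0//.
have stepE u : (forall i, (i < (size w).+1)%N -> coin_digits u i = nth false (b :: w) i)
   <-> (u < coin_prob) = b /\ forall i, (i < size w)%N -> coin_digits (coin_step u) i = nth false w i.
  split=> [h|[h1 h2] [|i] iw].
  - split; first exact: (h 0%N).
    by move=> i iw; rewrite -coin_digitsS h.
  - exact: h1.
  - by rewrite coin_digitsS h2.
case: b stepE => stepE.
  exists (coin_prob * a, coin_prob * c) => /=; split.
  - exact: mulr_ge0.
  - by rewrite mulr_ile1// (le_trans a0).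
  - exact: ler_wpM2l.
  - by rewrite big_cons -cE -mulrBr.
  - move=> u u01; rewrite stepE /coin_step; move: u01 => /andP[u0 u1].
    split=> [[uq]|/andP[u2 u3]].
      rewrite uq; have qp : 0 < coin_prob by lra.
      rewrite H; first by rewrite ler_pdivlMr// ltr_pdivrMr// ![_ * coin_prob]mulrC.
      by rewrite divr_ge0//= ltr_pdivrMr// mul1r.
    have qp : 0 < coin_prob.
      by rewrite lt0r q0 andbT; apply/eqP => q00; rewrite q00 !mul0r in u2 u3; lra.
    have uq : u < coin_prob by apply: (lt_le_trans u3); rewrite ger_pMr.
    split => //; rewrite uq.
    apply/H; first by rewrite divr_ge0//= ltr_pdivrMr// mul1r.
    by rewrite ler_pdivlMr// ltr_pdivrMr// ![_ * coin_prob]mulrC u2.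
exists (coin_prob + (1 - coin_prob) * a, coin_prob + (1 - coin_prob) * c) => /=; split.
- by rewrite addr_ge0// mulr_ge0// subr_ge0.
- have : (1 - coin_prob) * c <= 1 - coin_prob by rewrite ler_piMr// subr_ge0.
  lra.
- by rewrite lerD2l ler_wpM2l// subr_ge0.
- by rewrite big_cons -cE /bernoulli_pmf/=; ring.
- move=> u u01; rewrite stepE /coin_step; move: u01 => /andP[u0 u1].
  have key : coin_prob <= u -> 0 < 1 - coin_prob /\ 0 <= (u - coin_prob) / (1 - coin_prob) < 1.
    move=> qu; have q1' : 0 < 1 - coin_prob by lra.
    split => //; rewrite divr_ge0/= ?ltr_pdivrMr// ?mul1r; lra.
  split=> [[uq]|/andP[u2 u3]].
    rewrite uq; move/negbT : uq; rewrite -leNgt => /key[q1' k].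
    rewrite (H _ k) ler_pdivlMr// ltr_pdivrMr// ![_ * (1 - coin_prob)]mulrC.
    by rewrite lerBrDl ltrBlDl.
  have qu : coin_prob <= u.
    by apply: le_trans u2; rewrite lerDl mulr_ge0// subr_ge0.
  have [q1' k] := key qu.
  rewrite ltNge qu; split => //=.
  apply/(H _ k).
  rewrite ler_pdivlMr// ltr_pdivrMr// ![_ * (1 - coin_prob)]mulrC.
  by rewrite lerBrDl ltrBlDl u2.
Qed.

Lemma measurable_coin_step : measurable_fun setT coin_step.
Proof.
rewrite /coin_step; apply: measurable_fun_ifT => /=.
- exact: measurable_fun_ltr.
- exact: measurable_funM.
- by apply: measurable_funM => //; exact: measurable_funB.
Qed.

Lemma measurable_coin_digits :
  measurable_fun setT coin_digits.
Proof.
apply: (@measurability _ _ (measurableTypeR R) binary_seq setT coin_digits coordinate_sets) => //.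
move=> _ [_ [i [B ->]] <-]; rewrite setTI.
have m : measurable_fun setT (fun u : R => (iter i coin_step u < coin_prob)%R).
  apply: measurable_fun_ltr => //.
  elim: i => [|i ih /=]; first exact: measurable_id.
  exact: (measurableT_comp measurable_coin_step ih).
by have /(_ B I) := m measurableT; rewrite setTI.
Qed.

HB.instance Definition _ :=
  isMeasurableFun.Build _ _ (measurableTypeR R) binary_seq coin_digits
    measurable_coin_digits.

Let I01 : set (measurableTypeR R) := `[0, 1[%classic.
Let mI : measurable I01. Proof. exact: measurable_itv. Qed.

Definition uniform01 : set (measurableTypeR R) -> \bar R :=
  mrestr lebesgue_measure mI.
HB.instance Definition _ := Measure.on uniform01.

Let uniform01T : uniform01 setT = 1%E.
Proof.
rewrite /uniform01 /mrestr setTI.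
by rewrite lebesgue_measure_itv/= lte_fin ltr01 oppr0 adde0.
Qed.

HB.instance Definition _ :=
  Measure_isProbability.Build _ _ _ uniform01 uniform01T.

Definition coin_law : probability binary_seq R :=
  distribution uniform01 coin_digits.

Lemma coin_law_cyl (w : seq bool) :
  coin_law [set x | forall i, (i < size w)%N -> x i = nth false w i] =
  (\prod_(b <- w) bernoulli_prob p [set b])%E.
Proof.
have [[a c] /= [a0 c1 ac cE H]] := coin_cylinder w.
transitivity (\prod_(b <- w) bernoulli_pmf coin_prob b)%:E; last first.
  elim: w {H cE} => [|b w ih]; first by rewrite !big_nil.
  by rewrite !big_cons EFinM ih bernoulli_prob1.
rewrite /coin_law/= /distribution /pushforward/= /uniform01 /mrestr.
rewrite (_ : _ `&` _ = `[a, c[%classic).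
  rewrite lebesgue_measure_itv/= lte_fin -cE.
  by case: ltgtP ac => // -> _; rewrite subrr.
apply/seteqP; split=> u /=; rewrite /I01 /= !in_itv/=.
  by move=> [h u01]; apply/H.
move=> acu; have u01 : 0 <= u < 1.
  case/andP: acu => au uc.
  by rewrite (le_trans a0)//= (lt_le_trans uc).
by split => //; apply/H.
Qed.

Lemma measurable_coin_cylinder (D : nat -> set bool) n :
  measurable ([set x | forall i, (i < n)%N -> D i (x i)] : set binary_seq).
Proof.
rewrite (_ : [set x | _] = \bigcap_(i in `I_n) ([set x | D i (x i)])); last first.
  by apply/seteqP; split.
apply: bigcap_measurableType => // i _.
by apply: sub_sigma_algebra; exists i, (D i).
Qed.

Lemma coin_law_rect n (A : nat -> set bool) (w : seq bool) :
  coin_law [set x | (forall i, (i < size w)%N -> x i = nth false w i) /\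
     forall i, (i < n)%N -> A i (x (size w + i)%N)] =
  ((\prod_(b <- w) bernoulli_prob p [set b]) *
   \prod_(i < n) bernoulli_prob p (A i))%E.
Proof.
elim: n A w => [|n ih] A w.
  rewrite big_ord0 mule1 -coin_law_cyl; congr (coin_law _).
  by apply/seteqP; split => x //= [].
pose E b := [set x : binary_seq | A 0%N b] `&`
  [set x : binary_seq | (forall i, (i < size (rcons w b))%N -> x i = nth false (rcons w b) i) /\
     forall i, (i < n)%N -> A i.+1 (x (size (rcons w b) + i)%N)].
have mE b : measurable (E b).
  rewrite /E; apply: measurableI.
    have [h|h] := pselect (A 0%N b).
      by rewrite (_ : [set _ | _] = setT)//; apply/seteqP; split.
    by rewrite (_ : [set _ | _] = set0)//; apply/seteqP; split.
  rewrite (_ : [set x | _] = [set x : binary_seq | forall i, (i < size (rcons w b))%N ->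
      (fun i => [set c | c = nth false (rcons w b) i]) i (x i)] `&`
    [set x : binary_seq | forall i, (i < size (rcons w b) + n)%N ->
      (fun i => [set c | (size (rcons w b) <= i)%N -> A (i - size (rcons w b)).+1 c]) i (x i)]).
    apply: measurableI.
      exact: (measurable_coin_cylinder (fun i => [set c | c = nth false (rcons w b) i])).
    exact: (measurable_coin_cylinder (fun i => [set c |
      (size (rcons w b) <= i)%N -> A (i - size (rcons w b)).+1 c])).
  apply/seteqP; split=> x /= [h1 h2]; split => // i hi.
    by move=> si; have := h2 (i - size (rcons w b))%N; rewrite subnKC// ltn_subLR// => /(_ hi).
  by have := h2 (size (rcons w b) + i)%N; rewrite ltn_add2l leq_addr addKn => /(_ hi isT).
have Eb b : coin_law (E b) = (bernoulli_prob p (A 0%N `&` [set b]) *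
  ((\prod_(b <- w) bernoulli_prob p [set b]) * \prod_(i < n) bernoulli_prob p (A i.+1)))%E.
  rewrite /E; have [h|h] := pselect (A 0%N b).
    rewrite (_ : [set _ | A 0%N b] = setT) ?setTI; last by apply/seteqP; split.
    rewrite (ih (A \o S)) (_ : _ `&` _ = [set b]); last first.
      by apply/seteqP; split => x /= => [[]//|->].
    by rewrite -cats1 big_cat/= big_seq1 [X in (X * _)%E]muleC muleA.
  rewrite (_ : [set _ | A 0%N b] = set0) ?set0I; last by apply/seteqP; split.
  rewrite (_ : _ `&` [set b] = set0) ?measure0 ?mul0e//.
  by apply/seteqP; split => x //= [+ xb]; rewrite xb.
rewrite (_ : [set x | _] = E true `|` E false).
  have -> : coin_law (E true `|` E false) =
      (coin_law (E true) + coin_law (E false))%E.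
    apply: measureU => //.
    apply/seteqP; split => x //= [[_ [h1 _]] [_ [h2 _]]].
    have := h1 (size w); rewrite h2 ?size_rcons// !nth_rcons ltnn eqxx.
    by move=> /(_ (ltnSn _)).
  rewrite !Eb -ge0_muleDl ?measure_ge0//.
  rewrite -measureU//; last first.
    by apply/seteqP; split => x //= [[_ ->] []].
  rewrite -setIUr -setT_bool setIT big_ord_recl muleCA.
  by [].
apply/seteqP; split => x /=.
  move=> [h1 h2].
  suff : E (x (size w)) x by case: (x (size w)) => h; [left|right].
  split; first by have := h2 0%N; rewrite addn0; exact.
  split=> i.
    rewrite size_rcons ltnS leq_eqVlt nth_rcons => /predU1P[->|iw].
      by rewrite ltnn eqxx.
    by rewrite iw h1.
  by rewrite size_rcons addSnnS => hi; exact: h2.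
suff H b : E b x -> (forall i, (i < size w)%N -> x i = nth false w i) /\
     forall i, (i < n.+1)%N -> A i (x (size w + i)%N) by case; exact: H.
rewrite /E /= size_rcons => -[h0 [h1 h2]]; split=> [i iw|[|i] hi].
- by rewrite h1 ?nth_rcons ?iw// ltnS ltnW.
- by rewrite addn0 h1// nth_rcons ltnn eqxx.
- by rewrite addnS -addSn; exact: h2.
Qed.

Lemma bernoulli_product_exists :
  exists P : probability binary_seq R, is_bernoulli_product p P.
Proof.
exists coin_law => n A; have := coin_law_rect n A [::].
rewrite big_nil mul1e => <-; congr (coin_law _).
by apply/seteqP; split => x /= => [h|[]].
Qed.

End bernoulli_product_exists.

Definition bernoulli_seq (R : realType) (p : R) : probability binary_seq R :=
  projT1 (cid (bernoulli_product_exists p)).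

Lemma bernoulli_seqP (R : realType) (p : R) :
  is_bernoulli_product p (bernoulli_seq p).
Proof. exact: projT2 (cid (bernoulli_product_exists p)). Qed.

(* Ber(p)^k *)
Definition bernoulli_tuple (R : realType) (p : R) (k : nat) :
    set (k.-tuple bool) -> \bar R :=
  fun A => (\sum_(w \in A) \prod_(i < k) bernoulli_prob p [set tnth w i])%E.

Section bernoulli_tuple_probability.
Context (R : realType) (p : R) (k : nat).
Local Open Scope ereal_scope.

Let weight (w : k.-tuple bool) : \bar R :=
  \prod_(i < k) bernoulli_prob p [set tnth w i].

Let weight_ge0 w : 0 <= weight w.
Proof. by apply: prode_ge0 => i _; exact: measure_ge0. Qed.

Let bernoulli_tuple0 : bernoulli_tuple p (set0 : set (k.-tuple bool)) = 0.
Proof. by rewrite /bernoulli_tuple fsbig_set0. Qed.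

Let bernoulli_tuple_ge0 (A : set (k.-tuple bool)) : 0 <= bernoulli_tuple p A.
Proof. by apply: fsume_ge0 => w _; exact: weight_ge0. Qed.

Let bernoulli_tuple_sigma_additive :
  semi_sigma_additive (@bernoulli_tuple R p k).
Proof.
have E (A : set (k.-tuple bool)) : bernoulli_tuple p A = \esum_(w in A) weight w.
  by rewrite esum_fset//; exact: finite_finset.
move=> F mF tF mUF; apply: cvg_toP.
  by apply: is_cvg_nneseries => n _ _; exact: bernoulli_tuple_ge0.
under eq_eseriesr do rewrite E.
by rewrite E nneseries_sum_bigcup.
Qed.

HB.instance Definition _ := isMeasure.Build _ _ _ (@bernoulli_tuple R p k)
  bernoulli_tuple0 bernoulli_tuple_ge0 bernoulli_tuple_sigma_additive.

Let bernoulli_tupleT : bernoulli_tuple p [set: k.-tuple bool] = 1.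
Proof.
transitivity (\sum_(w : k.-tuple bool) weight w).
  rewrite fsbig_seq ?index_enum_uniq//.
  rewrite (_ : [set` index_enum _] = setT)//.
  by apply/seteqP; split => w //= _; rewrite mem_index_enum.
under eq_bigr do rewrite /weight; under eq_bigr do under eq_bigr do rewrite bernoulli_prob1.
under eq_bigr do rewrite prodEFin.
rewrite sumEFin (reindex (fun f : {ffun 'I_k -> bool} => [tuple f i | i < k])).
  under eq_bigr do under eq_bigr do rewrite tnth_mktuple.
  rewrite -(bigA_distr_bigA (fun=> fun b => bernoulli_pmf (coin_prob p) b)).
  rewrite big1// => i _; rewrite big_bool/= /bernoulli_pmf/=.
  by rewrite addrC subrK.
exists (fun w : k.-tuple bool => [ffun i => tnth w i]) => [f _|w _].
  by apply/ffunP => i; rewrite ffunE tnth_mktuple.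
by apply: eq_from_tnth => i; rewrite tnth_mktuple ffunE.
Qed.

HB.instance Definition _ :=
  Measure_isProbability.Build _ _ R (@bernoulli_tuple R p k) bernoulli_tupleT.

End bernoulli_tuple_probability.

Arguments bernoulli_tuple {R} p k.

(* Stretches (x_j, ..., x_{j+k-1}), 1 <= j <= n, become those starting at
   the indices 0, ..., n - 1. *)
Definition occurrences (n : nat) (x : binary_seq) (k : nat)
    (w : k.-tuple bool) : nat :=
  #|[pred j : 'I_n | [tuple x (j + i)%N | i < k] == w]|.

Definition occurrences_rv (R : realType) (n : nat) (x : binary_seq)
    (k : nat) (w : k.-tuple bool) : R :=
  (occurrences n x w)%:R.
Arguments occurrences_rv R n x k w : clear implicits.

Lemma measurable_set_tuple_bool k (A : set (k.-tuple bool)) : measurable A.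
Proof.
rewrite -[A]image_id -bigcup_imset1; apply: fin_bigcup_measurable => [|w _].
  exact: finite_finset.
rewrite (_ : [set w] = \bigcap_(i in [set: 'I_k])
    ((fun v : k.-tuple bool => tnth v i) @^-1` [set tnth w i])).
  apply: fin_bigcap_measurable => // i _; rewrite -[X in measurable X]setTI.
  exact: measurable_tnth.
apply/seteqP; split => [v -> //|v h]; apply: eq_from_tnth => i.
exact: h.
Qed.

Lemma measurable_occurrences_rv (R : realType) (n : nat)
    (x : binary_seq) (k : nat) :
  measurable_fun setT (@occurrences_rv R n x k).
Proof. by move=> _ B _; exact: measurable_set_tuple_bool. Qed.

HB.instance Definition _ (R : realType) (n : nat) (x : binary_seq)
    (k : nat) :=
  isMeasurableFun.Build _ _ _ _ (@occurrences_rv R n x k)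
    (@measurable_occurrences_rv R n x k).

Definition cvg_in_distribution (R : realType)
    (d : measure_display) (T : nat -> measurableType d)
    (P : forall k, probability (T k) R) (X : forall k, {RV (P k) >-> R})
    (d' : measure_display) (T' : measurableType d')
    (Q : probability T' R) (Y : {RV Q >-> R}) : Prop :=
  forall r : R, {for r, continuous (cdf Y)} ->
    cdf (X k) r @[k --> \oo] --> cdf Y r.

(* Main.v *)
(* By Markov's inequality it is enough that the probability of 1 <= M_k <= K, averaged over
   both x and w, tends to 0 for every K: then for almost every x the law of
   M_k^x puts vanishing mass on (0, K] along a subsequence, so a limit law
   has no mass on (0, oo). Given w, M_k has mean a = N_k * mu(w). If a is small
   the union bound makes M_k = 0 likely; if a is large the second moment method
   makes M_k > K likely, since two overlapping occurrences of w with shift l have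
   probability at most mu(w) * max(p, 1 - p)^l. The window eps < a < b has
   vanishing probability: mu(w) depends only on the number of ones in w, and
   since p <> 1/2 the window allows a bounded number of values for it, whereas
   the largest atom of the binomial law tends to 0. *)
Require Import Defs.
From mathcomp Require Import all_boot all_order all_algebra.
From mathcomp Require Import all_classical all_reals all_analysis.
From mathcomp Require Import measurable_realfun probability.
From mathcomp Require Import ring lra zify.
Import Order.TTheory GRing.Theory Num.Theory.
Import numFieldNormedType.Exports.
Local Open Scope classical_set_scope.
Local Open Scope ring_scope.

(** * The largest atom of the binomial law tends to 0 *)

Section binomial_anticoncentration.
Context (R : realType) (p : R).

(** The binomial law with parameters [k] and [p], by conditioning on one trial. The recursion
    replaces the closed form because the energy argument compares the laws for [k] and [k.+1]. *)
Fixpoint binomial_mass (k j : nat) : R :=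
  if k is k'.+1 then
    p * (if j is j'.+1 then binomial_mass k' j' else 0)
    + (1 - p) * binomial_mass k' j
  else (j == 0%N)%:R.

Lemma binomial_mass_small k j : (k < j)%N -> binomial_mass k j = 0.
Proof.
elim: k j => [|k IH] [|j]//= kj.
by rewrite !IH ?mulr0 ?addr0// ltnW.
Qed.

Hypothesis p01 : 0 < p < 1.

Lemma binomial_mass_ge0 k j : 0 <= binomial_mass k j.
Proof.
have /andP[p0 p1] := p01.
elim: k j => [|k IH] j /=; first exact: ler0n.
apply: addr_ge0; apply: mulr_ge0 => //; try lra.
by case: j.
Qed.

Lemma binomial_mass_sum_le1 k n : \sum_(j < n) binomial_mass k j <= 1.
Proof.
have /andP[p0 p1] := p01.
elim: k n => [|k IH] n /=.
  case: n => [|n]; first by rewrite big_ord0 ler01.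
  by rewrite big_ord_recl /= big1 ?addr0.
case: n => [|n]; first by rewrite big_ord0 ler01.
rewrite big_split/= -!mulr_sumr [X in p * X]big_ord_recl /= add0r.
have q0 : 0 < 1 - p by lra.
rewrite -[leRHS](subrKC p); apply: lerD.
  by rewrite ger_pMr//; exact: IH.
by rewrite ger_pMr//; exact: IH.
Qed.

Let increment k j : R :=
  binomial_mass k j - (if j is j'.+1 then binomial_mass k j' else 0).

Let energy k : R := \sum_(j < k.+1) binomial_mass k j ^+ 2.

(** Sum over [j] the identity [(p u + q v)^2 = p u^2 + q v^2 - p q (v - u)^2], [q = 1 - p], where
    [v] is the mass at [j] and [u] the mass at [j - 1]. The squares of [u] and of [v] both sum to
    [energy k], since the mass vanishes at [-1] and at [k.+1]. *)
Let energyS k :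
  energy k.+1 = energy k - p * (1 - p) * \sum_(j < k.+2) increment k j ^+ 2.
Proof.
pose pred_mass j : R := if j is j'.+1 then binomial_mass k j' else 0.
have A : \sum_(j < k.+2) pred_mass j ^+ 2 = energy k.
  by rewrite big_ord_recl /= expr0n /= add0r.
have B : \sum_(j < k.+2) binomial_mass k j ^+ 2 = energy k.
  by rewrite big_ord_recr /= binomial_mass_small// expr0n /= addr0.
transitivity (p * \sum_(j < k.+2) pred_mass j ^+ 2
    + (1 - p) * \sum_(j < k.+2) binomial_mass k j ^+ 2
    - p * (1 - p) * \sum_(j < k.+2) increment k j ^+ 2); last by rewrite A B; ring.
rewrite !mulr_sumr -big_split/= -sumrB; apply: eq_bigr => j _.
have -> : binomial_mass k.+1 j = p * pred_mass j + (1 - p) * binomial_mass k j by [].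
rewrite (_ : increment k j = binomial_mass k j - pred_mass j)//; ring.
Qed.

Let energy_noninc : nonincreasing_seq energy.
Proof.
have /andP[p0 p1] := p01.
apply/nonincreasing_seqP => k; rewrite energyS gerBl.
by rewrite mulr_ge0// ?sumr_ge0// => [|i _]; rewrite ?sqr_ge0// mulr_ge0//; lra.
Qed.

(* The energy decreases to a limit, so its decrements, which control the
   increments of the mass function, tend to 0. *)
Let increment_small e : 0 < e ->
  \forall k \near \oo, forall j, `|increment k j| <= e.
Proof.
move=> e0; have /andP[p0 p1] := p01.
have ce : cvgn energy.
  apply: nonincreasing_is_cvgn => //.
  exists 0 => _ [k _ <-]; apply: sumr_ge0 => j _; exact: sqr_ge0.
have dcv : energy n - energy n.+1 @[n --> \oo] --> (0 : R).
  rewrite -(subrr (limn energy)); apply: cvgB => //.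
  by rewrite (cvg_shiftS energy).
have d0 : 0 < p * (1 - p) * e ^+ 2 by rewrite !mulr_gt0// ?exprn_gt0//; lra.
near=> k.
have dk : energy k - energy k.+1 < p * (1 - p) * e ^+ 2.
  near: k; exact: cvgr_lt dcv _ d0.
move=> j; have [kj|jk] := ltnP k.+1 j.
  rewrite /increment binomial_mass_small ?(ltnW kj)//.
  by case: j kj => // j kj; rewrite binomial_mass_small// subrr normr0 ltW.
rewrite -(@ler_pXn2r _ 2)// ?nnegrE ?(ltW e0)// real_normK ?num_real//.
have pq0 : 0 < p * (1 - p) by apply: mulr_gt0; lra.
rewrite -(ler_pM2l pq0); apply/ltW/(le_lt_trans _ dk).
rewrite energyS opprB subrKC ler_pM2l//.
rewrite (bigD1 (Ordinal (jk : (j < k.+2)%N)))//= lerDl.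
by apply: sumr_ge0 => i _; exact: sqr_ge0.
Unshelve. all: by end_near. Qed.

(** Increments of size at most [e / (2 n)] bound the mass at [j] by [e / 2] plus the average of the
    [n] masses from [j] on. The total mass being at most 1, this average is at most
    [1 / n <= e / 2]. *)
Lemma binomial_mass_uniformly_small e : 0 < e ->
  \forall k \near \oo, forall j, binomial_mass k j <= e.
Proof.
move=> e0.
have [n n0 ne] : exists2 n : nat, (0 < n)%N & 1 <= n%:R * (e / 2).
  exists (Num.truncn (2 / e)).+1 => //.
  rewrite -ler_pdivrMr ?divr_gt0// mul1r invf_div; apply: ltW.
  exact: truncnS_gt.
have d0 : 0 < e / (2 * n%:R) by rewrite divr_gt0// mulr_gt0// ltr0n.
near=> k => j.
have Hk : forall j, `|increment k j| <= e / (2 * n%:R).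
  by near: k; exact: increment_small.
have step i : binomial_mass k j <= binomial_mass k (j + i) + i%:R * (e / (2 * n%:R)).
  elim: i => [|i IH]; first by rewrite addn0 mul0r addr0.
  apply: (le_trans IH); rewrite -[i.+1%:R]natr1.
  have := Hk (j + i.+1)%N; rewrite addnS /increment ler_norml => /andP[+ _].
  lra.
have S1 : \sum_(i < n) binomial_mass k (j + i) <= 1.
  apply: le_trans (binomial_mass_sum_le1 k (j + n)).
  by rewrite big_split_ord /= lerDr sumr_ge0// => i _; exact: binomial_mass_ge0.
have n0R : 0 < n%:R :> R by rewrite ltr0n.
rewrite -(ler_pM2l n0R).
have -> : n%:R * e = n%:R * (e / 2) + n%:R * (e / 2) by field.
apply: (@le_trans _ _ (1 + n%:R * (e / 2))); last by rewrite lerD2r.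
apply: le_trans (lerD S1 (lexx _)).
have -> : n%:R * binomial_mass k j = \sum_(i < n) binomial_mass k j.
  by rewrite sumr_const card_ord mulr_natl.
have -> : n%:R * (e / 2) = \sum_(i < n) (n%:R * (e / (2 * n%:R))) .
  rewrite sumr_const card_ord -[RHS]mulr_natl; field; exact: lt0r_neq0.
rewrite -big_split /=; apply: ler_sum => i _.
apply: (le_trans (step i)); rewrite lerD2l ler_wpM2r ?(ltW d0)//.
by rewrite ler_nat ltnW.
Unshelve. all: by end_near. Qed.

End binomial_anticoncentration.

(** * The mass of a word under the product law, and its number of ones *)

Definition word_weight (R : realType) (p : R) (w : seq bool) : R :=
  \prod_(b <- w) bernoulli_pmf p b.
Arguments word_weight {R} p w.

Lemma sum_tuple_cons (R : nmodType) (T : finType) k (h : seq T -> R) :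
  \sum_(w : k.+1.-tuple T) h w = \sum_(b : T) \sum_(w : k.-tuple T) h (b :: w).
Proof.
rewrite pair_bigA /= (reindex (fun bw : T * k.-tuple T => [tuple of bw.1 :: bw.2])) //=.
exists (fun w : k.+1.-tuple T => (thead w, [tuple of behead w])) => [[b w] _|w _] /=.
  by rewrite theadE; congr pair; apply/val_inj.
by rewrite [RHS]tuple_eta; apply/val_inj.
Qed.

Section word_weight.
Context (R : realType) (p : R).

Lemma word_weight_count w :
  word_weight p w = p ^+ count id w * (1 - p) ^+ (size w - count id w).
Proof.
elim: w => [|b w IH]; first by rewrite /word_weight big_nil subnn !expr0 mulr1.
rewrite {1}/word_weight big_cons -/(word_weight p w) IH.
have := count_size id w; case: b => /= cw; rewrite ?add1n ?add0n ?subSS.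
  by rewrite exprS mulrA.
by rewrite subSn// exprS mulrCA.
Qed.

(** The number of ones in a random word has the binomial law. The test function [G] is arbitrary so
    that the induction can pass to its shift when the first letter is a one. *)
Lemma sum_word_weight_count k (G : nat -> R) :
  \sum_(w : k.-tuple bool) word_weight p w * G (count id w) =
  \sum_(j < k.+1) binomial_mass R p k j * G j.
Proof.
elim: k G => [|k IH] G.
  rewrite big_ord_recl big_ord0 addr0 /= mul1r.
  rewrite (big_pred1 [tuple]) => [|w]; first by rewrite /word_weight big_nil mul1r.
  by apply/esym/eqP; exact: tuple0.
rewrite (sum_tuple_cons R _ k (fun w => word_weight p w * G (count id w))) big_bool.
transitivity (p * (\sum_(w : k.-tuple bool) word_weight p w * G (count id w).+1) +
    (1 - p) * \sum_(w : k.-tuple bool) word_weight p w * G (count id w)).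
  by congr (_ + _); rewrite mulr_sumr; apply: eq_bigr => w _;
    rewrite {1}/word_weight big_cons -mulrA.
rewrite (IH (fun j => G j.+1)) IH.
rewrite !mulr_sumr.
under [RHS]eq_bigr do rewrite /= mulrDl.
rewrite big_split /=; congr (_ + _).
  rewrite [RHS]big_ord_recl /= mulr0 mul0r add0r.
  by apply: eq_bigr => j _; rewrite mulrA.
rewrite [RHS]big_ord_recr /= binomial_mass_small// mulr0 mul0r addr0.
by apply: eq_bigr => j _; rewrite mulrA.
Qed.

Lemma sum_word_weight k : \sum_(w : k.-tuple bool) word_weight p w = 1.
Proof.
elim: k => [|k IH].
  rewrite (big_pred1 [tuple]) => [|w]; first by rewrite /word_weight big_nil.
  by apply/esym/eqP; exact: tuple0.
rewrite (sum_tuple_cons R _ k (word_weight p)) big_bool /= /word_weight.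
under eq_bigr do rewrite big_cons.
under [X in _ + X]eq_bigr do rewrite big_cons.
by rewrite -!mulr_sumr IH !mulr1 subrKC.
Qed.

Hypothesis p01 : 0 < p < 1.

Lemma word_weight_gt0 w : 0 < word_weight p w.
Proof.
have /andP[p0 p1] := p01.
by apply: prodr_gt0 => -[] _ //=; lra.
Qed.

Lemma word_weight_le w : word_weight p w <= Num.max p (1 - p) ^+ size w.
Proof.
have /andP[p0 p1] := p01.
elim: w => [|b w IH]; first by rewrite /word_weight big_nil.
rewrite /word_weight big_cons exprS; apply: ler_pM => //.
- by case: b => /=; lra.
- exact/ltW/word_weight_gt0.
- by case: b; rewrite /= le_max lexx ?orbT.
Qed.

End word_weight.

(** * Words whose expected number of occurrences lies in a bounded window *)

Lemma exists_le_exprn (R : archiRealFieldType) (x c : R) :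
  1 < x -> exists n : nat, c <= x ^+ n.
Proof.
move=> x1; have h0 : 0 < x - 1 by rewrite subr_gt0.
(* Bernoulli's inequality. *)
have H n : n%:R * (x - 1) <= x ^+ n.
  elim: n => [|n IH]; first by rewrite mul0r expr0.
  have xn : 1 <= x ^+ n by rewrite exprn_ege1// ltW.
  rewrite exprS -natr1; nra.
exists (Num.truncn (c / (x - 1))).+1; apply: le_trans (H _).
by rewrite -ler_pdivrMr//; apply/ltW/truncnS_gt.
Qed.

Section window.
Context (R : realType) (p : R).
Hypotheses (p01 : 0 < p < 1) (p2 : p != 2^-1).

Let mass k j := p ^+ j * (1 - p) ^+ (k - j).

(* Changing one letter multiplies the weight by [p / (1 - p) != 1]. *)
Let window_diameter (a b : R) : 0 < a -> exists L, forall k n j j',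
  (j <= k)%N -> (j' <= k)%N -> a < n * mass k j < b -> a < n * mass k j' < b ->
  (j' <= j + L)%N.
Proof.
move=> a0; have /andP[p0 p1] := p01.
have q0 : 0 < 1 - p by lra.
have massE k j d : (j + d <= k)%N ->
    mass k (j + d) * (1 - p) ^+ d = mass k j * p ^+ d.
  move=> jd; rewrite /mass (_ : k - j = k - (j + d) + d)%N; last by lia.
  by rewrite !exprD; ring.
(* For [d > L] the ratio [(v / u)^d] reaches [b / a], so a change of [d] letters leaves the window.
   This [L] depends neither on [k] nor on [n]. *)
have dominate u v : 0 < u -> u < v ->
    exists L : nat, forall d, (L < d)%N -> b * u ^+ d <= a * v ^+ d.
  move=> u0 uv; have v0 := lt_trans u0 uv.
  have uv1 : 1 < v / u by rewrite ltr_pdivlMr// mul1r.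
  have [L HL] := exists_le_exprn _ _ (b / a) uv1.
  exists L => d Ld.
  have : b / a <= v ^+ d / u ^+ d.
    rewrite -expr_div_n; apply: le_trans HL _.
    by rewrite ler_eXn2l// ltnW.
  by rewrite ler_pdivrMr// mulrAC ler_pdivlMr ?exprn_gt0// [_ * a]mulrC.
(* The weight increases with the number of ones if [1 - p < p] and decreases if [p < 1 - p]; [p2]
   excludes equality. *)
have [qp|pq] := ltP (1 - p) p.
  have [L HL] := dominate _ _ q0 qp.
  exists L => k n j j' jk j'k /andP[aj jb] /andP[aj' j'b].
  rewrite leqNgt; apply/negP => jL.
  have jj' : (j <= j')%N by lia.
  have := HL (j' - j)%N; rewrite ltn_subRL => /(_ jL).
  have := massE k j (j' - j)%N; rewrite subnKC// => /(_ j'k).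
  set d := (j' - j)%N; move=> E; apply/negP; rewrite -ltNge.
  apply: (@lt_trans _ _ (n * mass k j * p ^+ d)); first by rewrite ltr_pM2r// exprn_gt0.
  by rewrite -mulrA -E mulrA ltr_pM2r// exprn_gt0.
have pq' : p < 1 - p.
  by rewrite lt_neqAle pq andbT; apply: contra p2 => /eqP pE; apply/eqP; lra.
have [L HL] := dominate _ _ p0 pq'.
exists L => k n j j' jk j'k /andP[aj jb] /andP[aj' j'b].
rewrite leqNgt; apply/negP => jL.
have jj' : (j <= j')%N by lia.
have := HL (j' - j)%N; rewrite ltn_subRL => /(_ jL).
have := massE k j (j' - j)%N; rewrite subnKC// => /(_ j'k).
set d := (j' - j)%N; move=> E; apply/negP; rewrite -ltNge.
apply: (@lt_trans _ _ (n * mass k j' * (1 - p) ^+ d)); first by rewrite ltr_pM2r// exprn_gt0.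
by rewrite -mulrA E mulrA ltr_pM2r// exprn_gt0.
Qed.

(** By [window_diameter] the words in the window have at most [L.+1] different numbers of ones, each
    of binomial mass at most [e / L.+1] for large [k]. Neither bound involves [n]. *)
Lemma sum_word_weight_window (a b e : R) : 0 < a -> 0 < e ->
  \forall k \near \oo, forall n : R,
    \sum_(w : k.-tuple bool | a < n * word_weight p w < b) word_weight p w <= e.
Proof.
move=> a0 e0; have [L HL] := window_diameter a b a0.
have L0 : 0 < L.+1%:R :> R by rewrite ltr0n.
near=> k => n.
pose W j := a < n * mass k j < b.
have -> : \sum_(w : k.-tuple bool | a < n * word_weight p w < b) word_weight p w =
    \sum_(j < k.+1 | W j) binomial_mass R p k j.
  transitivity (\sum_(w : k.-tuple bool) word_weight p w * (W (count id w))%:R).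
    rewrite big_mkcond; apply: eq_bigr => w _.
    have -> : (a < n * word_weight p w < b) = W (count id w).
      by rewrite word_weight_count size_tuple.
    by case: (W _); rewrite ?mulr1 ?mulr0.
  rewrite (sum_word_weight_count R p k (fun j => (W j)%:R)) [RHS]big_mkcond.
  by apply: eq_bigr => j _; case: (W _); rewrite ?mulr1 ?mulr0.
have small : forall j, binomial_mass R p k j <= e / L.+1%:R.
  by near: k; apply: binomial_mass_uniformly_small => //; rewrite divr_gt0.
apply: le_trans (ler_sum _ (fun (j : 'I_k.+1) _ => small j)) _.
rewrite sumr_const -[leLHS]mulr_natl mulrCA ger_pMr// ler_pdivrMr// mul1r ler_nat.
have [j0 Wj0|W0] := pickP (fun j : 'I_k.+1 => W j); last first.
  by rewrite eq_card0.
(* All admissible values lie between [m] and [m + L], so [j - m] embeds them in ['I_L.+1]. *)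
pose m := [arg min_(j < j0 | W j) (j : nat)]%N.
have [Wm mmin] : W m /\ forall j : 'I_k.+1, W j -> (m <= j)%N.
  by rewrite /m; case: arg_minnP.
rewrite -[L.+1]card_ord.
apply: (leq_card_in (fun j : 'I_k.+1 => inord (j - m) : 'I_L.+1)) => i j.
rewrite !unfold_in => Wi Wj /(congr1 val) /=.
have b1 := HL k n m i (ltn_ord m) (ltn_ord i) Wm Wi.
have b2 := HL k n m j (ltn_ord m) (ltn_ord j) Wm Wj.
have := mmin i Wi; have := mmin j Wj => mj mi.
rewrite !inordK; try lia.
by move=> E; apply: val_inj => /=; lia.
Unshelve. all: by end_near. Qed.

End window.

(** * First and second moments of the number of occurrences *)

(** Integration of the pointwise inequality. The union bound, the second moment bound and Markov's
    inequality below are all instances. *)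
Lemma sum_measure_le_of_indic {d} {T : measurableType d} {R : realType}
    (P : probability T R) {I J : Type} (r : seq I) (s : seq J)
    (a : I -> R) (A : I -> set T) (b : J -> R) (B : J -> set T) :
  (forall i, 0 <= a i) -> (forall i, measurable (A i)) ->
  (forall j, 0 <= b j) -> (forall j, measurable (B j)) ->
  (forall x, \sum_(i <- r) a i * \1_(A i) x <= \sum_(j <- s) b j * \1_(B j) x) ->
  \sum_(i <- r) a i * fine (P (A i)) <= \sum_(j <- s) b j * fine (P (B j)).
Proof.
have integralE (L : Type) (u : seq L) (c : L -> R) (C : L -> set T) :
    (forall l, 0 <= c l) -> (forall l, measurable (C l)) ->
    (\int[P]_x (\sum_(l <- u) c l * \1_(C l) x)%:E)%E =
    (\sum_(l <- u) c l * fine (P (C l)))%:E.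
  move=> c0 mC; under eq_integral do rewrite -sumEFin.
  rewrite ge0_integral_sum//=; last 2 first.
  - by move=> l; apply/measurable_EFinP; apply: measurable_funM.
  - by move=> l x _; rewrite lee_fin mulr_ge0.
  rewrite -sumEFin; apply: eq_bigr => l _.
  under eq_integral do rewrite EFinM.
  rewrite ge0_integralZl_EFin//; last first.
    by apply/measurable_EFinP.
  by rewrite integral_indic// setIT EFinM fineK// fin_num_measure.
have msum (L : Type) (u : seq L) (c : L -> R) (C : L -> set T) :
    (forall l, measurable (C l)) ->
    measurable_fun setT (fun x => (\sum_(l <- u) c l * \1_(C l) x)%:E).
  move=> mC; apply/measurable_EFinP.
  apply: (measurable_sum u (h := fun l x => c l * \1_(C l) x)) => l.
  exact: measurable_funM.
move=> a0 mA b0 mB le; rewrite -lee_fin -!integralE//.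
apply: ge0_le_integral => //=.
- by move=> x _; rewrite lee_fin sumr_ge0// => i _; rewrite mulr_ge0.
- exact: msum.
- exact: msum.
- by move=> x _; rewrite lee_fin.
Qed.

Definition occurs_at (i : nat) (w : seq bool) : set binary_seq :=
  [set x | forall t, (t < size w)%N -> x (i + t)%N = nth false w t].

Lemma measurable_occurs_at i w : measurable (occurs_at i w).
Proof.
rewrite (_ : occurs_at i w = [set x : binary_seq | forall t, (t < i + size w)%N ->
    (fun t => [set b | (i <= t)%N -> b = nth false w (t - i)]) t (x t)]).
  exact: (measurable_coin_cylinder (fun t => [set b | (i <= t)%N -> b = nth false w (t - i)])).
apply/seteqP; split => x /= h t tw.
  by move=> it; have := h (t - i)%N; rewrite subnKC//; apply; rewrite ltn_subLR.
by have := h (i + t)%N; rewrite ltn_add2l addKn leq_addr; apply.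
Qed.

Lemma occurrencesE (R : realType) n k x (w : k.-tuple bool) :
  (occurrences n x w)%:R = \sum_(j < n) \1_(occurs_at j w) x :> R.
Proof.
rewrite /occurrences -sum1_card big_mkcond natr_sum; apply: eq_bigr => j _.
rewrite indicE inE; congr ((nat_of_bool _)%:R); apply/eqP/idP.
  move=> <-; apply/mem_set => t; rewrite size_tuple => tk.
  by rewrite -[t]/(val (Ordinal tk)) -tnth_nth tnth_mktuple.
move=> /set_mem wx; apply: (congr1 val); apply: eq_from_tnth => i.
by rewrite tnth_mktuple (tnth_nth false) wx// size_tuple.
Qed.

Section occurrence_probability.
Context (R : realType) (p : R) (P : probability binary_seq R).
Hypotheses (p01 : 0 < p < 1) (HP : is_bernoulli_product p P).

Let measurable_leq (f g : binary_seq -> nat) :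
  measurable_fun setT (fun x => (f x)%:R : R) ->
  measurable_fun setT (fun x => (g x)%:R : R) ->
  measurable [set x | (f x <= g x)%N].
Proof.
move=> mf mg.
have := measurable_fun_ler mf mg measurableT (Y := [set true]) I.
rewrite setTI (_ : _ @^-1` _ = [set x | (f x <= g x)%N])//.
by apply/seteqP; split => x /=; rewrite ler_nat => ->.
Qed.

Let measurable_occurrences n k (w : k.-tuple bool) :
  measurable_fun setT (fun x => (occurrences n x w)%:R : R).
Proof.
under [X in measurable_fun _ X]eq_fun do rewrite occurrencesE.
apply: measurable_sum => j; apply: measurable_indic.
exact: measurable_occurs_at.
Qed.

Lemma measurable_occurrences_le n k (w : k.-tuple bool) K :
  measurable [set x : binary_seq | (occurrences n x w <= K)%N].
Proof. exact: measurable_leq. Qed.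

Lemma measurable_occurrences_ge n k (w : k.-tuple bool) K :
  measurable [set x : binary_seq | (K <= occurrences n x w)%N].
Proof. exact: measurable_leq. Qed.

Lemma measurable_occurrences_between n k (w : k.-tuple bool) K :
  measurable [set x : binary_seq | (0 < occurrences n x w <= K)%N].
Proof.
rewrite (_ : [set x | _] = [set x | (0 < occurrences n x w)%N] `&`
                           [set x | (occurrences n x w <= K)%N]).
  apply: measurableI; first exact: measurable_occurrences_ge.
  exact: measurable_occurrences_le.
by apply/seteqP; split => x /= /andP.
Qed.

Let bernoulli_prob_set1 b : bernoulli_prob p [set b] = (bernoulli_pmf p b)%:E.
Proof.
rewrite bernoulli_prob1 /coin_prob; have /andP[/ltW-> /ltW->] := p01.
by [].
Qed.

(* [None] leaves the corresponding coordinate free. *)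
Let pattern_probability (u : seq (option bool)) :
  P [set x | forall t, (t < size u)%N ->
       if nth None u t is Some b then x t = b else True] =
  (\prod_(o <- u) if o is Some b then bernoulli_pmf p b else 1)%:E.
Proof.
pose A t : set bool := if nth None u t is Some b then [set b] else setT.
rewrite (_ : [set x | _] = [set x | forall t, (t < size u)%N -> A t (x t)]); last first.
  by apply/seteqP; split => x /= h t /h; rewrite /A; case: (nth None u t).
rewrite HP (big_nth None) big_mkord -prodEFin; apply: eq_bigr => t _.
rewrite /A; case: (nth None u t) => [b|]; first exact: bernoulli_prob_set1.
exact: probability_setT.
Qed.

(** Stretches without a common coordinate are independent; [g] is the length of the gap between
    them. The joint event is one pattern: [i] free coordinates, [v], [g] free coordinates, [w]. *)
Let probability_occurs2 i g v w :
  P (occurs_at i v `&` occurs_at (i + size v + g) w) =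
  (word_weight p v * word_weight p w)%:E.
Proof.
pose u := nseq i None ++ map Some v ++ nseq g None ++ map Some w.
have -> : occurs_at i v `&` occurs_at (i + size v + g) w =
    [set x | forall t, (t < size u)%N ->
       if nth None u t is Some b then x t = b else True].
  apply/seteqP; split => x /=.
    move=> [xv xw] t; rewrite /u !size_cat !size_nseq !size_map => tu.
    rewrite !nth_cat !size_nseq !size_map !nth_nseq.
    case: ltnP => // it; case: ltnP => tv.
      by rewrite (nth_map false)// -xv// subnKC.
    case: ltnP => // tg; rewrite (nth_map false); last by lia.
    rewrite -xw; last by lia.
    by congr x; lia.
  move=> xu; split => t tw.
    have := xu (i + t)%N.
    rewrite {2}/u !nth_cat !size_nseq !size_map addKn.
    rewrite (_ : (i + t < i)%N = false); last by lia.
    rewrite tw (nth_map false)//; apply.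
    by rewrite /u !size_cat !size_nseq !size_map; lia.
  have /xu : (i + size v + g + t < size u)%N.
    by rewrite /u !size_cat !size_nseq !size_map; lia.
  rewrite /u !nth_cat !size_nseq !size_map.
  do 3 (case: ltnP => ?; first lia).
  rewrite (_ : _ + t - _ - _ - _ = t)%N; last by lia.
  by rewrite (nth_map false).
rewrite pattern_probability; congr EFin.
rewrite /u !big_cat /= !big_map !big_nseq /=.
by rewrite !iter_mulr_1 !expr1n !mul1r.
Qed.

Let probability_occurs i w : P (occurs_at i w) = (word_weight p w)%:E.
Proof.
rewrite -[RHS](_ : (word_weight p w * word_weight p [::])%:E = _); last first.
  by rewrite {2}/word_weight big_nil mulr1.
rewrite -(probability_occurs2 i 0).
by congr (P _); apply/seteqP; split => x //= -[].
Qed.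


Let q := Num.max p (1 - p).

Let q_gt0 : 0 < q.
Proof. by have /andP[p0 _] := p01; rewrite lt_max p0. Qed.

Let q_lt1 : q < 1.
Proof. by have /andP[p0 p1] := p01; rewrite gt_max p1 gtrBl. Qed.

(* An occurrence at [i + l] with [l < k] extends an occurrence at [i] by a
   prescribed word of length [l]. *)
Let probability_occurs_shift i l w :
  fine (P (occurs_at i w `&` occurs_at (i + l) w)) <=
  word_weight p w ^+ 2 + word_weight p w * q ^+ l.
Proof.
have w0 := ltW (word_weight_gt0 R p p01 w).
have [lw|wl] := ltnP l (size w).
  apply: (@le_trans _ _ (word_weight p w * q ^+ l)); last first.
    by rewrite lerDr exprn_ge0.
  pose v := drop (size w - l) w.
  have sv : size v = l by rewrite size_drop subKn// ltnW.
  apply: (@le_trans _ _ (word_weight p w * word_weight p v)); last first.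
    by rewrite ler_wpM2l// -sv; exact: word_weight_le.
  rewrite -lee_fin -(probability_occurs2 i 0) fineK ?fin_num_measure//; last first.
    by apply: measurableI; exact: measurable_occurs_at.
  apply: le_measure; rewrite ?inE; do ?[by apply: measurableI; exact: measurable_occurs_at].
  move=> x [xi xl]; split => // t; rewrite sv => tl.
  rewrite nth_drop -xl; last by lia.
  by congr x; lia.
(* Without overlap the two occurrences are independent, which accounts for the squared weight. *)
rewrite (_ : i + l = i + size w + (l - size w))%N; last by lia.
rewrite probability_occurs2 /= -expr2 lerDl mulr_ge0// exprn_ge0//.
exact: ltW.
Qed.

Let sum_geometric_tail n i :
  \sum_(j < n) (if (i <= j)%N then q ^+ (j - i) else 0) <= (1 - q)^-1.
Proof.
have q1 : 0 < 1 - q by rewrite subr_gt0.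
(* The induction runs on the exact partial sum; for [n <= i] truncated subtraction makes it 0, as it
   should be. *)
apply: (@le_trans _ _ ((1 - q ^+ (n - i)) / (1 - q))); last first.
  by rewrite ler_pdivrMr// mulVf ?gt_eqF// gerBl exprn_ge0// ltW.
elim: n => [|n IH]; first by rewrite big_ord0 sub0n expr0 subrr mul0r.
rewrite big_ord_recr /=; case: ifPn => [ni|]; last first.
  rewrite -ltnNge => ni; rewrite addr0.
  by apply: le_trans IH _; rewrite (_ : n - i = n.+1 - i)%N//; lia.
apply: le_trans (lerD IH (lexx _)) _.
rewrite -[X in _ + X](mulfK (lt0r_neq0 q1)) -mulrDl ler_pM2r ?invr_gt0//.
by rewrite subSn// exprS; set c := q ^+ _; rewrite le_eqVlt; apply/orP; left; apply/eqP; ring.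
Qed.

(** The left side is the second moment of the number of occurrences. Pairs at distance [l] exceed
    the independent value by at most the weight times [q ^+ l], and these errors form geometric
    series. *)
Lemma sum_probability_occurs2_le n w :
  \sum_(i < n) \sum_(j < n) fine (P (occurs_at i w `&` occurs_at j w)) <=
  (n%:R * word_weight p w) ^+ 2 + n%:R * word_weight p w * (2 / (1 - q)).
Proof.
have w0 := ltW (word_weight_gt0 R p p01 w).
(* [h i j + h j i] dominates [q] to the power of the distance of [i] and [j]; the two orders give
   the factor 2 in the bound. *)
pose h (i j : nat) : R := if (i <= j)%N then q ^+ (j - i) else 0.
have h0 i j : 0 <= h i j by rewrite /h; case: ifP => // _; rewrite exprn_ge0// ltW.
have bound (i j : nat) : fine (P (occurs_at i w `&` occurs_at j w)) <=
    word_weight p w ^+ 2 + word_weight p w * (h i j + h j i).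
  wlog ij : i j / (i <= j)%N.
    move=> H; have [|/ltnW] := leqP i j; first exact: H.
    by move=> /H; rewrite setIC [h i j + _]addrC.
  have := probability_occurs_shift i (j - i) w; rewrite subnKC// => /le_trans; apply.
  rewrite lerD2l ler_wpM2l// {1}/h ij lerDl; exact: h0.
apply: (@le_trans _ _ (\sum_(i < n) \sum_(j < n)
    (word_weight p w ^+ 2 + word_weight p w * (h i j + h j i)))).
  by apply: ler_sum => i _; apply: ler_sum => j _; exact: bound.
have S : \sum_(i < n) \sum_(j < n) h i j <= n%:R * (1 - q)^-1.
  rewrite mulr_natl -[X in _ *+ X]card_ord -sumr_const; apply: ler_sum => i _.
  exact: sum_geometric_tail.
have -> : \sum_(i < n) \sum_(j < n)
    (word_weight p w ^+ 2 + word_weight p w * (h i j + h j i)) =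
    n%:R ^+ 2 * word_weight p w ^+ 2 +
    word_weight p w * (\sum_(i < n) \sum_(j < n) h i j +
                       \sum_(i < n) \sum_(j < n) h i j).
  transitivity (\sum_(i < n) (n%:R * word_weight p w ^+ 2 +
      word_weight p w * (\sum_(j < n) h i j + \sum_(j < n) h j i))).
    apply: eq_bigr => i _; rewrite big_split /= sumr_const card_ord mulr_natl.
    by rewrite -mulr_sumr big_split.
  rewrite big_split /= sumr_const card_ord -[X in X + _]mulr_natl [X in X + _]mulrA -expr2; congr (_ + _).
  rewrite -mulr_sumr big_split /=; congr (_ * (_ + _)).
  by rewrite exchange_big.
rewrite exprMn lerD2l; have := ler_wpM2l w0 S; lra.
Qed.

(** The indicator of at least one occurrence is bounded by the number of occurrences, whose mean is
    the right side. *)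
Lemma probability_occurrences_gt0_le n k (w : k.-tuple bool) :
  fine (P [set x | (0 < occurrences n x w)%N]) <= n%:R * word_weight p w.
Proof.
have -> : n%:R * word_weight p w = \sum_(i < n) 1 * fine (P (occurs_at i w)).
  under eq_bigr do rewrite probability_occurs mul1r.
  by rewrite sumr_const card_ord mulr_natl.
have := @sum_measure_le_of_indic _ _ _ P unit _ [:: tt] (index_enum 'I_n)
  (fun=> 1) (fun=> [set x | (0 < occurrences n x w)%N])
  (fun=> 1) (fun i => occurs_at i w).
rewrite big_seq1 mul1r; apply => //.
- by move=> _; exact: measurable_occurrences_ge.
- by move=> i; exact: measurable_occurs_at.
move=> x; rewrite big_seq1 mul1r.
under eq_bigr do rewrite mul1r.
rewrite -occurrencesE indicE; case: (boolP (x \in _)) => [/set_mem /= M0|_]; last exact: ler0n.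
by rewrite ler1n.
Qed.

(* Second moment method: [M <= K <= a / 2] forces [(M - a)^2 >= (a / 2)^2],
   where [a] is the mean of [M]. *)
Lemma probability_occurrences_le_le n k (w : k.-tuple bool) K :
  let a := n%:R * word_weight p w in
  0 < a -> 2 * K%:R <= a ->
  fine (P [set x | (occurrences n x w <= K)%N]) <= 8 / (1 - q) / a.
Proof.
move=> a a0 Ka.
pose E i := occurs_at i w.
have mE i : measurable (E i) by exact: measurable_occurs_at.
(* The pointwise inequality is [(a / 2)^2 * 1_(M <= K) + 2 a M <= a^2 + M^2]: the square [(M - a)^2]
   is expanded and its cross term moved to the left to keep all coefficients nonnegative. [None]
   indexes the first term of each side, [Some] the occurrences in [M] and the pairs in [M^2]. *)
have := @sum_measure_le_of_indic _ _ _ P _ _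
  (None :: map Some (index_enum 'I_n))
  (None :: map Some (index_enum ('I_n * 'I_n)%type))
  (fun o => if o is Some _ then 2 * a else (a / 2) ^+ 2)
  (fun o => if o is Some i then E i else [set x | (occurrences n x w <= K)%N])
  (fun o => if o is Some _ then 1 else a ^+ 2)
  (fun o => if o is Some (i, j) then E i `&` E j else setT).
rewrite !big_cons !big_map => H.
have {H} : (a / 2) ^+ 2 * fine (P [set x | (occurrences n x w <= K)%N]) +
    2 * a * a <= a ^+ 2 + (a ^+ 2 + a * (2 / (1 - q))).
  apply: (@le_trans _ _ ((a / 2) ^+ 2 * fine (P [set x | (occurrences n x w <= K)%N]) +
      \sum_(i < n) 2 * a * fine (P (E i)))).
    rewrite lerD2l -mulr_sumr; under eq_bigr do rewrite probability_occurs.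
    by rewrite sumr_const card_ord -[X in _ <= _ * X]mulr_natl.
  apply: (le_trans (H _ _ _ _ _)).
  - by move=> [_|]; [lra|exact: sqr_ge0].
  - by move=> [i|]; [exact: mE|exact: measurable_occurrences_le].
  - by move=> [_|]; [lra|exact: sqr_ge0].
  - by move=> [[i j]|//]; exact: measurableI.
  - move=> x; rewrite !big_cons !big_map.
    rewrite -mulr_sumr -occurrencesE.
    under [X in _ <= _ + X]eq_bigr => ij _.
      rewrite (_ : (let (i, j) := ij in E i `&` E j) = E ij.1 `&` E ij.2); last by case: ij.
      rewrite mul1r indicI /=.
      over.
    rewrite -(pair_bigA _ (fun i j : 'I_n => \1_(E i) x * \1_(E j) x)) /=.
    rewrite -big_distrlr /= -occurrencesE !indicE in_setT mulr1.
    set M := (occurrences n x w)%:R.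
    case: (boolP (x \in _)) => [/set_mem /=|_] /=; last first.
      by have := sqr_ge0 (M - a); lra.
    rewrite -(ler_nat R) -/M => MK.
    have : 0 <= (a - M - a / 2) * (a - M + a / 2) by apply: mulr_ge0; lra.
    lra.
  rewrite probability_setT /= mulr1 lerD2l.
  under eq_bigr => ij _.
    rewrite (_ : (let (i, j) := ij in E i `&` E j) = E ij.1 `&` E ij.2); last by case: ij.
    rewrite mul1r.
    over.
  rewrite -(pair_bigA _ (fun i j : 'I_n => fine (P (E i `&` E j)))) /=.
  exact: sum_probability_occurs2_le.
set Pr := fine _ => H.
rewrite ler_pdivlMr//.
have a2 : 0 < a / 4 by lra.
rewrite -(ler_pM2l a2); lra.
Qed.

End occurrence_probability.

(** * From the average over all sequences to almost every sequence *)

Lemma annealed_occurrences_small (R : realType) (p : R)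
    (P : probability binary_seq R) (p01 : 0 < p < 1) (p2 : p != 2^-1)
    (HP : is_bernoulli_product p P) K (e : R) :
  0 < e -> \forall k \near \oo, forall n : nat,
    \sum_(w : k.-tuple bool) word_weight p w *
      fine (P [set x | (0 < occurrences n x w <= K)%N]) <= e.
Proof.
move=> e0; have /andP[p0 p1] := p01.
have q0 : 0 < 1 - Num.max p (1 - p) by rewrite subr_gt0 gt_max p1 gtrBl.
set c := 8 / (1 - Num.max p (1 - p)).
have c0 : 0 < c by rewrite divr_gt0.
have e2 : 0 < e / 2 by rewrite divr_gt0.
(* A mean [a >= b] satisfies the hypothesis [2 K <= a] of the second moment bound and makes that
   bound, [c / a], at most [e / 2]. *)
pose b := Num.max (2 * K%:R) (c / (e / 2)).
have [k0 _ Hk0] := sum_word_weight_window R p p01 p2 _ b _ e2 e2.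
exists k0 => // k k0k n.
have W : \sum_(w : k.-tuple bool | e / 2 < n%:R * word_weight p w < b)
    word_weight p w <= e / 2 by exact: Hk0.
have mhit w : measurable [set x | (0 < @occurrences n x k w <= K)%N].
  exact: measurable_occurrences_between R _ _ _ _.
(* One half pays for the words outside the window, where the probability is at most [e / 2]; the
   other half is the total weight of the window, where the probability is bounded by 1. *)
have -> : e = e / 2 + e / 2 by field.
apply: le_trans (lerD (lexx _) W).
have {1}-> : e / 2 = \sum_(w : k.-tuple bool) word_weight p w * (e / 2).
  by rewrite -mulr_suml sum_word_weight mul1r.
rewrite [X in _ + X]big_mkcond -big_split /=; apply: ler_sum => w _.
have w0 := word_weight_gt0 R p p01 w.
set a := n%:R * word_weight p w.
have hit1 : fine (P [set x | (0 < occurrences n x w <= K)%N]) <= 1.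
  rewrite -lee_fin fineK ?fin_num_measure//; exact: probability_le1.
have hit_ge0 : 0 <= fine (P [set x | (0 < occurrences n x w <= K)%N]) by exact: fine_ge0.
have [ae|ea] := leP a (e / 2).
  rewrite addr0 ler_pM2l//; apply: le_trans ae.
  apply: le_trans (probability_occurrences_gt0_le R p P p01 HP n k w).
  apply: fine_le; rewrite ?fin_num_measure//; first exact: measurable_occurrences_ge R _ _ _ _.
  apply: le_measure; rewrite ?inE//; first exact: measurable_occurrences_ge R _ _ _ _.
  by move=> x /= /andP[].
have [ab|ba] /= := ltP a b.
  have := ler_wpM2l (ltW w0) hit1.
  have := mulr_ge0 (ltW w0) (ltW e2); lra.
rewrite addr0 ler_pM2l//.
have a0 : 0 < a by exact: lt_trans ea.
move: ba; rewrite ge_max => /andP[Ka ca].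
apply: (@le_trans _ _ (c / a)); last first.
  by rewrite ler_pdivrMr// mulrC -ler_pdivrMr.
apply: le_trans (probability_occurrences_le_le R p P p01 HP n k w K a0 Ka).
apply: fine_le; rewrite ?fin_num_measure//; first exact: measurable_occurrences_le R _ _ _ _.
apply: le_measure; rewrite ?inE//; first exact: measurable_occurrences_le R _ _ _ _.
by move=> x /= /andP[].
Qed.

(** By Markov's inequality the probability of [large k] tends to 0, so the intersection of all
    [large k] with [k0 <= k] is null. The exceptional set is the countable union of these
    intersections over [k0]. *)
Lemma ae_quenched_occurrences_small (R : realType) (p : R)
    (P : probability binary_seq R) (p01 : 0 < p < 1) (p2 : p != 2^-1)
    (HP : is_bernoulli_product p P) (N : nat -> nat) K (e : R) :
  0 < e -> {ae P, forall x, forall k0, exists2 k, (k0 <= k)%N &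
    \sum_(w : k.-tuple bool | (0 < occurrences (N k) x w <= K)%N)
      word_weight p w < e}.
Proof.
move=> e0.
pose hit k (w : k.-tuple bool) : set binary_seq :=
  [set x | (0 < occurrences (N k) x w <= K)%N].
have mhit k (w : k.-tuple bool) : measurable (hit k w).
  exact: measurable_occurrences_between R _ _ _ _.
pose f k (x : binary_seq) : R := \sum_(w : k.-tuple bool) word_weight p w * \1_(hit k w) x.
have fE k x : \sum_(w : k.-tuple bool | (0 < occurrences (N k) x w <= K)%N)
    word_weight p w = f k x.
  rewrite big_mkcond; apply: eq_bigr => w _; rewrite indicE.
  case: ifPn => h; first by rewrite mem_set// mulr1.
  by rewrite memNset ?mulr0//; exact/negP.
pose large k := [set x | e <= f k x].
have mlarge k : measurable (large k).
  have mf : measurable_fun setT (f k).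
    apply: (measurable_sum (index_enum (k.-tuple bool))
      (h := fun w x => word_weight p w * \1_(hit k w) x)) => w.
    exact: measurable_funM.
  have := measurable_fun_ler (measurable_cst e) mf measurableT (Y := [set true]) I.
  by rewrite setTI (_ : _ @^-1` _ = large k)//; apply/seteqP; split.
pose B k0 := \bigcap_(k in [set k | (k0 <= k)%N]) large k.
have mB k0 : measurable (B k0) by apply: bigcap_measurableType.
have PB k0 : P (B k0) = 0%E.
  apply/eqP; rewrite eq_le measure_ge0 andbT; apply/lee_addgt0Pr => d d0.
  rewrite add0e.
  (* Markov's inequality divides by the threshold [e], which leaves [d]. *)
  have := annealed_occurrences_small R p P p01 p2 HP K (e * d) (mulr_gt0 e0 d0).
  move=> [k1 _ Hk1].
  pose k := maxn k0 k1.
  have Hk := Hk1 k (leq_maxr _ _) (N k).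
  apply: (@le_trans _ _ (P (large k))).
    apply: le_measure; rewrite ?inE// => x Bx; apply: Bx => /=; exact: leq_maxl.
  rewrite -[leLHS]fineK ?fin_num_measure// lee_fin -(ler_pM2l e0).
  apply: le_trans Hk.
  have := @sum_measure_le_of_indic _ _ _ P unit _ [:: tt] (index_enum (k.-tuple bool))
    (fun=> e) (fun=> large k) (fun w => word_weight p w) (hit k).
  rewrite big_seq1; apply => //.
  - by move=> _; exact: ltW.
  - by move=> w; exact/ltW/word_weight_gt0.
  move=> x; rewrite big_seq1 -/(f k x) indicE.
  case: (boolP (x \in _)) => [/set_mem|_]; rewrite ?mulr1// mulr0.
  by apply: sumr_ge0 => w _; rewrite mulr_ge0//; exact/ltW/word_weight_gt0.
apply: (@negligibleS _ _ _ P (\bigcup_k0 B k0)); last first.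
  by apply: negligible_bigcup => k0; apply/(negligibleP _ (mB k0)); exact: PB.
move=> x /= /existsNP[k0 nk0]; exists k0 => // k /= kk0.
rewrite /large /= leNgt; apply/negP => fk; apply: nk0; exists k => //.
by rewrite fE.
Qed.

(** * Continuity points of distribution functions and limit laws *)

Section cdf_continuity.
Context {d} {T : measurableType d} {R : realType} (Q : probability T R)
  (Y : {RV Q >-> R}).

(** Only left continuity is at stake: the events [r - 1 / n.+1 < Y <= r] decrease to [Y = r], which
    has probability 0. *)
Lemma continuous_cdf r : pmf Y r = 0 -> {for r, continuous (cdf Y)}.
Proof.
move=> Yr.
have Ffin x : cdf Y x \is a fin_num by rewrite fin_num_measure.
have E : (cdf Y r) = (fine (cdf Y r))%:E by rewrite fineK.
apply/left_right_continuousP; split; last exact: cdf_right_continuous.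
rewrite E; apply/fine_cvgP; split; first exact: nearW.
pose A n := Y @^-1` `]r - n.+1%:R^-1, r].
have mA n : measurable (A n) by exact: measurable_funPTI.
have AE : \bigcap_n A n = Y @^-1` [set r].
  apply/seteqP; split => t /=.
    move=> At; have Ytr : Y t <= r by have := At 0%N I; rewrite /A /= in_itv/= => /andP[].
    apply/eqP; rewrite eq_le Ytr /= leNgt; apply/negP => /ltr_add_invr[n nr].
    by have := At n I; rewrite /A /= in_itv/= ltrBlDr => /andP[/(lt_trans nr)]; rewrite ltxx.
  by move=> Yt n _; rewrite /A /= Yt in_itv/= lexx andbT gtrBl.
have cA : Q (A n) @[n --> \oo] --> 0%:E.
  have <- : Q (\bigcap_n A n) = 0%:E.
    by rewrite AE -Yr /pmf fineK// fin_num_measure//; exact: measurable_funPTI.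
  apply: nonincreasing_cvg_mu => //.
  - by rewrite -ge0_fin_numE// fin_num_measure.
  - by rewrite AE; exact: measurable_funPTI.
  - move=> m n mn; apply/subsetPset; apply: preimage_subset; apply: subset_itvr.
    by rewrite bnd_simp lerD2l lerN2 lef_pV2 ?posrE// ler_nat.
apply/cvgrPdist_le => e e0.
have [n _ /(_ _ (leqnn n)) /= An] := cvgr_lt _ (fine_cvg cA) _ e0.
near=> x.
have xr : x <= r by near: x; exact: nbhs_left_le.
have nx : r - n.+1%:R^-1 < x by near: x; apply: nbhs_left_gt; rewrite gtrBl.
have Fx : fine (cdf Y x) <= fine (cdf Y r) by rewrite fine_le// cdf_nondecreasing.
rewrite ger0_norm ?subr_ge0//; apply/ltW/(le_lt_trans _ An).
rewrite lerBlDl -lee_fin EFinD !fineK ?fin_num_measure//.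
have mx z : measurable (Y @^-1` `]-oo, z]) by exact: measurable_funPTI.
apply: (@le_trans _ _ (Q (Y @^-1` `]-oo, x] `|` A n))); last exact: measureU2.
rewrite -[cdf Y r]/(Q (Y @^-1` `]-oo, r])).
apply: le_measure; rewrite ?inE//; first exact: measurableU.
move=> t /=; rewrite !in_itv/= => Ytr.
have [|xY] := leP (Y t) x; [by left|right].
by rewrite /A /= in_itv/= Ytr andbT (lt_trans nx).
Unshelve. all: by end_near. Qed.

(** Discontinuities are atoms, of which there are countably many, whereas an interval of positive
    length has positive Lebesgue measure. *)
Lemma exists_continuous_cdf a b : a < b ->
  exists2 r, a < r < b & {for r, continuous (cdf Y)}.
Proof.
move=> ab; apply: contrapT => noc.
have : countable `]a, b[%classic.
  apply: sub_countable (pmf_gt0_countable Y); apply: subset_card_le => r /=.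
  rewrite in_itv/= => rab; rewrite lt0r pmf_ge0 andbT; apply/eqP => r0.
  by apply: noc; exists r => //; exact: continuous_cdf.
move/countable_lebesgue_measure0; rewrite lebesgue_measure_itv/= lte_fin ab.
by rewrite -EFinB => -[] /eqP; rewrite subr_eq0 gt_eqF.
Qed.

End cdf_continuity.

(* Between two positive continuity points the limit cdf is constant, hence
   equal to its limit 1 at infinity; thus the limit law is concentrated at 0. *)
Lemma cvg_in_distribution_eq0 {R : realType} {d : measure_display}
    {T : nat -> measurableType d} {P : forall k, probability (T k) R}
    (X : forall k, {RV (P k) >-> R}) {d' : measure_display}
    {T' : measurableType d'} {Q : probability T' R} (Y : {RV Q >-> R}) :
  (forall k t, 0 <= X k t) ->
  (forall (K : nat) (e : R), 0 < e -> forall k0, exists2 k, (k0 <= k)%N &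
     (P k [set t | (0 < X k t <= K%:R)%R] < e%:E)%E) ->
  cvg_in_distribution X Y -> {ae Q, forall t, Y t = 0}.
Proof.
move=> X0 gap XY.
pose F r := fine (cdf Y r).
have Ffin r : cdf Y r \is a fin_num by rewrite fin_num_measure.
have Xfin k r : cdf (X k) r \is a fin_num by rewrite fin_num_measure.
have Fle r s : r <= s -> F r <= F s by move=> rs; rewrite fine_le// cdf_nondecreasing.
have cvF r : {for r, continuous (cdf Y)} -> fine (cdf (X k) r) @[k --> \oo] --> F r.
  by move=> cr; apply: fine_cvg; rewrite fineK//; exact: XY.
have Fneg r : r < 0 -> F r = 0.
  move=> r0; have [s /andP[rs s0] cs] := exists_continuous_cdf Q Y r 0 r0.
  have Xs k : fine (cdf (X k) s) = 0.
    rewrite -[cdf (X k) s]/(P k (X k @^-1` `]-oo, s])).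
    rewrite (_ : _ @^-1` _ = set0) ?measure0//.
    apply/seteqP; split => t //=; rewrite in_itv/= => Xts.
    by have := le_lt_trans (le_trans (X0 k t) Xts) s0; rewrite ltxx.
  have Fs : F s = 0.
    apply: (cvg_unique _ (cvF s cs)) => //.
    rewrite (_ : (fun k => fine (cdf (X k) s)) = cst 0); first exact: cvg_cst.
    exact/funext.
  apply/eqP; rewrite eq_le fine_ge0// andbT -Fs; exact/Fle/ltW.
have Fconst r s : 0 < r -> {for r, continuous (cdf Y)} ->
    {for s, continuous (cdf Y)} -> F s <= F r.
  move=> r0 cr cs; rewrite leNgt; apply/negP => Frs.
  (* A third, for three errors: the convergence at [s], the convergence at [r], and the mass that
     [X k] puts between them. *)
  pose e := (F s - F r) / 3.
  have e0 : 0 < e by rewrite divr_gt0// subr_gt0.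
  have [k1 _ H1] : \forall k \near \oo, F s - e < fine (cdf (X k) s).
    by apply: cvgr_gt (cvF s cs) _ _; rewrite gtrBl.
  have [k2 _ H2] : \forall k \near \oo, fine (cdf (X k) r) < F r + e.
    by apply: cvgr_lt (cvF r cr) _ _; rewrite ltrDl.
  (* As [s] is below this integer and [r] is positive, the gap covers all values in []r, s]]. *)
  have [k k12 Pk] := gap (Num.truncn s).+1 e e0 (maxn k1 k2).
  have := H1 k (leq_trans (leq_maxl _ _) k12).
  have := H2 k (leq_trans (leq_maxr _ _) k12).
  set B := [set t | _] in Pk => /= h2 h1.
  have mB : measurable B.
    rewrite (_ : B = X k @^-1` `]0, (Num.truncn s).+1%:R]).
      exact: measurable_funPTI.
    by apply/seteqP; split => t /=; rewrite in_itv.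
  have : (cdf (X k) s <= cdf (X k) r + P k B)%E.
    have mx z : measurable (X k @^-1` `]-oo, z]) by exact: measurable_funPTI.
    apply: (@le_trans _ _ (P k (X k @^-1` `]-oo, r] `|` B))); last exact: measureU2.
    rewrite -[cdf (X k) s]/(P k (X k @^-1` `]-oo, s])).
    apply: le_measure; rewrite ?inE//; first exact: measurableU.
    move=> t /=; rewrite !in_itv/= => Xts.
    have [|rX] := leP (X k t) r; [by left|right].
    rewrite /B /= (lt_trans r0 rX) (le_trans Xts)//.
    exact/ltW/truncnS_gt.
  rewrite -[cdf (X k) s]fineK// -[cdf (X k) r]fineK// -[P k B]fineK ?fin_num_measure//.
  move: Pk; rewrite -[P k B]fineK ?fin_num_measure//.
  rewrite lte_fin -EFinD lee_fin /e in h1 h2 *; lra.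
have F1 r : 0 < r -> {for r, continuous (cdf Y)} -> 1 <= F r.
  move=> r0 cr; apply/ler_addgt0Pr => e e0.
  have : F x @[x --> +oo] --> (1 : R) by exact/fine_cvg/cvg_cdfy1.
  move=> /cvgr_gt /(_ (1 - e)); rewrite gtrBl => /(_ e0) [M [_ HM]].
  have M1 : M < M + 1 by rewrite ltrDl.
  have [s /andP[Ms _] cs] := exists_continuous_cdf Q Y M (M + 1) M1.
  have := HM s Ms; have := Fconst r s r0 cr cs; lra.
(* The limit cdf may jump at 0, so the value there comes from right continuity, through continuity
   points that decrease to 0. *)
have F0 : 1 <= F 0.
  rewrite leNgt; apply/negP => F01.
  have cF : F x @[x --> 0^'+] --> F 0.
    by apply: fine_cvg; rewrite fineK//; exact: cdf_right_continuous.
  have Fx1 := cvgr_lt _ cF _ F01.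
  near (0 : R)^'+ => x.
  have x0 : 0 < x by near: x; exact: nbhs_right_gt.
  have : F x < 1 by near: x; exact: Fx1.
  have [s /andP[s0 sx] cs] := exists_continuous_cdf Q Y 0 x x0.
  by rewrite ltNge (le_trans (F1 s s0 cs))// Fle// ltW.
have mY (I : interval R) : measurable (Y @^-1` [set` I]) by exact: measurable_funPTI.
apply: (@negligibleS _ _ _ Q
    (Y @^-1` `]0, +oo[ `|` \bigcup_n Y @^-1` `]-oo, - n.+1%:R^-1])).
  move=> t /= /eqP; rewrite neq_lt => /orP[Yt|Yt]; [right|left].
    have /ltr_add_invr[n] : 0 < - Y t by rewrite oppr_gt0.
    by rewrite add0r => nY; exists n => //=; rewrite in_itv/= lerNr ltW.
  by rewrite in_itv/= Yt.
apply: negligibleU.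
  apply/negligibleP => //.
  have -> : Y @^-1` `]0, +oo[ = ~` (Y @^-1` `]-oo, 0]).
    apply/seteqP; split => t /=; rewrite !in_itv/= andbT.
      by move=> Yt; apply/negP; rewrite -ltNge.
    by move/negP; rewrite -ltNge.
  apply: etrans (probability_setC Q (mY `]-oo, 0])) _.
  rewrite -[Q _]fineK ?fin_num_measure// -[fine _]/(F 0) -EFinB; congr EFin.
  apply/eqP; rewrite subr_eq0 eq_le F0 -lee_fin fineK//; exact: cdf_le1.
apply: negligible_bigcup => n; apply/(negligibleP _ (mY _)).
have <- : cdf Y (- n.+1%:R^-1) = 0%E by rewrite -[LHS]fineK// [X in X%:E]Fneg// oppr_lt0.
by [].
Unshelve. all: by end_near. Qed.

(** * Exclusion of nonzero limits for almost every sequence *)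

Lemma bernoulli_tupleE (R : realType) (p : R) (p01 : 0 < p < 1) k
    (B : pred (k.-tuple bool)) :
  bernoulli_tuple p k [set w | B w] = (\sum_(w | B w) word_weight p w)%:E.
Proof.
have weightE (w : k.-tuple bool) :
    (\prod_(i < k) bernoulli_prob p [set tnth w i])%E = (word_weight p w)%:E.
  rewrite /word_weight big_tuple -prodEFin; apply: eq_bigr => i _.
  by rewrite bernoulli_prob1 /coin_prob; have /andP[/ltW-> /ltW->] := p01.
rewrite /bernoulli_tuple (_ : [set w | B w] = [set` enum B]); last first.
  by apply/seteqP; split => w /=; rewrite mem_enum.
rewrite -fsbig_seq ?enum_uniq// big_enum -sumEFin.
by apply: eq_bigr => w _; exact: weightE.
Qed.

Theorem corollary1p2 (R : realType) (N : nat -> nat)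
    (hN : forall k, (1 <= k)%N -> (1 <= N k)%N)
    (p : R) (hp : 0 < p < 1) (hp2 : p != 2^-1) :
  {ae bernoulli_seq p, forall x : binary_seq,
    forall (d : measure_display) (T : measurableType d)
      (Q : probability T R) (Y : {RV Q >-> R}),
    ~ {ae Q, forall t, Y t = 0} ->
    ~ cvg_in_distribution
        (fun k =>
           occurrences_rv R (N k) x k : {RV (bernoulli_tuple p k) >-> R})
        Y}.
Proof.
(* A single integer serves as the bound on the number of occurrences and, through [1 / n.+1], as the
   tolerance. Countably many null sets are thus discarded before [K], [e] and the limit law are
   chosen. *)
have H : forall n : nat, {ae bernoulli_seq p, forall x, forall k0,
    exists2 k, (k0 <= k)%N &
    \sum_(w : k.-tuple bool | (0 < occurrences (N k) x w <= n)%N)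
      word_weight p w < n.+1%:R^-1}.
  move=> n; apply: (ae_quenched_occurrences_small R p _ hp hp2 (bernoulli_seqP p)).
  by rewrite invr_gt0.
have := ae_foralln H.
apply: filterS => x Hx d T Q Y Y0 XY; apply: Y0.
apply: cvg_in_distribution_eq0 XY => [k w|K e e0 k0]; first exact: ler0n.
(* [K <= n] enlarges the event, and [e^-1 < n.+1] brings the tolerance below [e]. *)
pose n := maxn K (Num.truncn e^-1).
have ne : n.+1%:R^-1 < e.
  rewrite invf_plt ?posrE//; apply: lt_le_trans (truncnS_gt _) _.
  by rewrite ler_nat ltnS leq_maxr.
have [k k0k Hk] := Hx n k0; exists k => //.
apply: (@lt_trans _ _ n.+1%:R^-1%:E); last by rewrite lte_fin.
rewrite (_ : [set t | _] = [set w | (0 < occurrences (N k) x w <= K)%N]); last first.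
  by apply/seteqP; split => w /=; rewrite /occurrences_rv ltr0n ler_nat.
rewrite [ltLHS](bernoulli_tupleE R p hp k (fun w => 0 < occurrences (N k) x w <= K)%N).
rewrite lte_fin; apply: le_lt_trans Hk.
rewrite big_mkcond [leRHS]big_mkcond; apply: ler_sum => w _.
have w0 := ltW (word_weight_gt0 R p hp w).
case: ifPn => [/andP[-> wK]|_]; last by case: ifP.
by rewrite (leq_trans wK (leq_maxl _ _)).
Qed.
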